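(* Let $A=[a_{ij}]\in\mathbb{R}^{n\times n}$ be the adjacency matrix of a connected simple undirected weighted graph $\mathcal{G}$ with $n$ nodes, $m$ edges and positive edge weights. Let $L$ be the graph Laplacian of $\mathcal{G}$, let $\mu>0$ be its Fiedler value, assumed to be a simple eigenvalue of $L$, and let $v=[v_1,\dots,v_n]^T$ be a Fiedler vector of unit Euclidean norm. Let $Y=[y_{ij}]\in\mathbb{R}^{n\times n}$ be the strictly lower triangular matrix with entries $y_{ij}=(v_i-v_j)^2$, $i>j$, and let $Y|_{\mathcal{L}}$ denote the projection of $Y$ onto the sparsity structure of the matrix $A$. Define the Fiedler impact matrix $$R^{(\mu)}=\frac{1}{\mu}\,A|_{\mathcal{L}}\circ Y|_{\mathcal{L}},$$ where $\circ$ denotes the Hadamard (entrywise) product. Then the $(i,j)$th entry of $R^{(\mu)}$ for $i>j$ approximates the impact of the edge $e(i\leftrightarrow j)$ in $\mathcal{G}$ on the Fiedler value. When the graph $\mathcal{G}$ is unweighted, $$\|R^{(\mu)}\|_F=\frac{1}{\mu}\,\|Y|_{\mathcal{L}}\|_F\le\frac{2\sqrt{m}}{\mu}.$$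
   Context: The graph $\mathcal{G}$ has nodes $1,\dots,n$, no self-loops and no multiple edges. Its adjacency matrix $A=[a_{ij}]$ is symmetric with zero diagonal; $a_{ij}=a_{ji}>0$ is the weight of the edge between nodes $i$ and $j$, denoted $e(i\leftrightarrow j)$, if there is such an edge, and $a_{ij}=0$ otherwise. The graph is unweighted if all nonvanishing entries of $A$ are equal to one. The graph Laplacian is $L=D-A$ with $D=\mathrm{diag}[d_1,\dots,d_n]$, $d_j=\sum_{k=1}^n a_{jk}$. It is symmetric positive semidefinite, and, since $\mathcal{G}$ is connected, its null space has dimension one. The Fiedler value $\mu>0$ is the second smallest eigenvalue of $L$, and a Fiedler vector is an associated eigenvector of unit Euclidean norm. The impact of the edge $e(i\leftrightarrow j)$ on the Fiedler value refers to the relative change $(\mu-\mu^{(\tau)})/\mu$, where, for $0<\tau\le1$, $\mu^{(\tau)}$ is the second smallest eigenvalue of the graph Laplacian of the graph obtained from $\mathcal{G}$ by replacing the weight $a_{ij}=a_{ji}$ by $(1-\tau)a_{ij}$. The case of particular interest is $\tau=1$, which corresponds to removing the edge. The word ''approximates'' is used informally, in the sense of the first-order estimate $(\mu-\mu^{(\tau)})/\mu\approx\frac{\tau}{\mu}a_{ij}(v_i-v_j)^2$; no error bound is asserted. $\mathcal{L}$ is the cone of real nonnegative $n\times n$ matrices with the same sparsity structure as the strictly lower triangular part of $A$. For a nonnegative matrix $N$, the projection $N|_{\mathcal{L}}$ keeps the entries of $N$ at positions $(i,j)$ with $i>j$ and $a_{ij}\neq0$, and sets all other entries to zero. $\|\cdot\|_F$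 is the Frobenius norm. *)

(* Defs.v *)
(* MathComp (with real-closed and MathComp-Analysis), R : realType. *)
From mathcomp Require Import all_boot all_order all_algebra.
From mathcomp Require Import polyrcf.
From mathcomp Require Import reals.
Set Implicit Arguments.
Unset Strict Implicit.
Unset Printing Implicit Defensive.
Import Order.TTheory GRing.Theory Num.Theory.
Local Open Scope ring_scope.

Section Graph.
Variables (R : realType) (n : nat).
Implicit Types (A M N : 'M[R]_n) (v : 'cV[R]_n).

(* A weighted simple undirected graph on 'I_n is given by its adjacency
   matrix; the edges are the positions of the nonzero entries. *)
Definition is_adjacency A : Prop :=
  [/\ A^T = A, forall i, A i i = 0 & forall i j, 0 <= A i j].

Definition edge A : rel 'I_n := fun i j => A i j != 0.

Definition connected_graph A : Prop := forall i j, connect (edge A) i j.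

Definition unweighted A : Prop := forall i j, edge A i j -> A i j = 1.

(* Each undirected edge is counted once, at its position below the diagonal. *)
Definition num_edges A : nat :=
  #|[set p : 'I_n * 'I_n | (p.2 < p.1)%N && edge A p.1 p.2]|.

Definition degree_mx A : 'M[R]_n := diag_mx (\row_j \sum_k A j k).

Definition laplacian A : 'M[R]_n := degree_mx A - A.

(* Real eigenvalues in nondecreasing order, repeated according to algebraic
   multiplicity ([rootsR] lists the distinct real roots increasingly).  For
   symmetric M all eigenvalues are real, so this list has length n. *)
Definition eigenvalues M : seq R :=
  flatten [seq nseq (mup x (char_poly M)) x | x <- rootsR (char_poly M)].

(* Second smallest eigenvalue of the Laplacian; meaningful for n >= 2. *)
Definition fiedler_value A : R := (eigenvalues (laplacian A))`_1.

Definition simple_eigenvalue M (x : R) : Prop := mup x (char_poly M) = 1%N.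

Definition reweight_edge A (i j : 'I_n) (t : R) : 'M[R]_n :=
  \matrix_(k, l) if ((k, l) == (i, j)) || ((k, l) == (j, i))
                 then (1 - t) * A k l else A k l.

(* Relative change of the Fiedler value when the weight of the edge between
   i and j is multiplied by 1 - t; t = 1 removes the edge. *)
Definition fiedler_impact A (i j : 'I_n) (t : R) : R :=
  (fiedler_value A - fiedler_value (reweight_edge A i j t)) / fiedler_value A.

Definition proj_lower A N : 'M[R]_n :=
  \matrix_(i, j) if (j < i)%N && edge A i j then N i j else 0.

Definition hadamard M N : 'M[R]_n := map2_mx *%R M N.

Definition diff_sq_mx v : 'M[R]_n :=
  \matrix_(i, j) if (j < i)%N then (v i 0 - v j 0) ^+ 2 else 0.

Definition fiedler_impact_mx A v : 'M[R]_n :=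
  (fiedler_value A)^-1 *:
    hadamard (proj_lower A A) (proj_lower A (diff_sq_mx v)).

End Graph.

(* On column vectors this is the Euclidean norm. *)
Definition frobenius_norm (R : realType) (p q : nat) (M : 'M[R]_(p, q)) : R :=
  Num.sqrt (\sum_i \sum_j M i j ^+ 2).

Definition is_fiedler_vector (R : realType) (n : nat) (A : 'M[R]_n)
    (v : 'cV[R]_n) : Prop :=
  laplacian A *m v = fiedler_value A *: v /\ frobenius_norm v = 1.

(* Main.v *)
Require Import Defs.
From mathcomp Require Import all_boot all_order all_algebra.
From mathcomp Require Import boolp classical_sets reals topology normedtype.
From mathcomp Require Import polyrcf derive realfun.
From mathcomp Require Import ring lra.
Set Implicit Arguments.
Unset Strict Implicit.
Unset Printing Implicit Defensive.
Import Order.TTheory GRing.Theory Num.Theory.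
Import numFieldNormedType.Exports.
Local Open Scope ring_scope.
Local Open Scope classical_set_scope.

(* Scaling the weight [w] of the edge [i <-> j] by [1 - t] changes [L] into
   [L - t w u u^T] with [u = e_i - e_j], so the characteristic polynomial
   [p = (X - mu) G] becomes [p + t w q] with [q = u^T adj(X - L) u].  As 0
   remains a root and no root becomes negative, the second smallest root is,
   for small [t], the root [y] near [mu], and [(y - mu) G(y) = - t w q(y)] gives
   [(y - mu) / t --> - w q(mu) / G(mu)].  Finally
   [adj(mu - L) = G(mu) v v^T], whence [q(mu) / G(mu) = (v_i - v_j)^2].
   If [mu = 0], both the impact and the impact matrix vanish because
   [x / 0 = 0]. *)

(** * Rank-one updates of determinants and adjugates of characteristic matrices *)

(* Compute the determinant of [[M, -c], [r, 1]] by eliminating the lower left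
   block with the identity, and the same block with [\adj M]. *)
Lemma det_rank1_update (R : idomainType) (n : nat) (M : 'M[R]_n)
    (c : 'cV[R]_n) (r : 'rV[R]_n) :
  \det M != 0 ->
  \det (M + c *m r) = \det M + (r *m \adj M *m c) 0 0.
Proof.
move=> d0; set d := \det M in d0 *.
pose B := block_mx M (- c) r (1%:M : 'M[R]_1).
have detB : \det B = \det (M + c *m r).
  have : B *m block_mx 1%:M 0 (- r) 1%:M = block_mx (M + c *m r) (- c) 0 1%:M.
    by rewrite mulmx_block !mulmx1 !mul1mx !mulmx0 mulNmx mulmxN opprK subrr !add0r.
  move/(congr1 determinant).
  by rewrite det_mulmx det_lblock det_ublock !det1 !mulr1.
have : block_mx (\adj M) 0 (- (r *m \adj M)) d%:M *m B =
       block_mx d%:M (- (\adj M *m c)) 0 (r *m \adj M *m c + d%:M).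
  rewrite mulmx_block !mul0mx !addr0 !mulNmx mulmxN mulmxN opprK mulmx1.
  by rewrite -(mulmxA r _ M) mul_adj_mx mul_mx_scalar mul_scalar_mx addNr.
move/(congr1 determinant).
rewrite det_mulmx det_lblock det_ublock !det_scalar detB det_mx11 !mxE expr1 -/d.
(* The extra factor [d] completes [\det (\adj M)] to [\det (M *m \adj M)], which is [d ^+ n]; both
   [d] and this power then cancel in the domain. *)
rewrite eqxx mulr1n => /(congr1 ( *%R d)).
have -> : d * (\det (\adj M) * d * \det (M + c *m r)) =
  (\det M * \det (\adj M)) * (d * \det (M + c *m r)) by rewrite /d; ring.
rewrite -det_mulmx mul_mx_adj det_scalar -/d mulrCA => /(mulfI d0).
by move=> /(mulfI (expf_neq0 n d0)) ->; rewrite addrC.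
Qed.

Lemma row'_submx (F : fieldType) (m n : nat) (i : 'I_m) (A : 'M[F]_(m, n)) :
  (row' i A <= A)%MS.
Proof.
apply/row_subP => k; have -> : row k (row' i A) = row (lift i k) A.
  by apply/rowP => j; rewrite !mxE.
exact: row_sub.
Qed.

(** A nonzero cofactor is an invertible minor of size [n.-1], and deleting a row or a column cannot
    increase the rank. *)
Lemma mxrank_adj_neq0 (F : fieldType) (n : nat) (A : 'M[F]_n) :
  \adj A != 0 -> (n.-1 <= \rank A)%N.
Proof.
apply: contra_neqT; rewrite -ltnNge => rkA.
apply/matrixP => i j; rewrite !mxE /cofactor.
set C := row' _ _; suff /eqP -> : \det C == 0 by rewrite mulr0.
apply: contraTT rkA; rewrite -unitfE -leqNgt => Cu.
rewrite -[X in (X <= _)%N](mxrank_unit (Cu : C \in unitmx)).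
apply: leq_trans (mxrankS (row'_submx _ _)) _.
by rewrite -mxrank_tr tr_col' -[leqRHS]mxrank_tr mxrankS ?row'_submx.
Qed.

Lemma map_horner_polyC (R : comNzRingType) (a : R) (m n : nat) (N : 'M[R]_(m, n)) :
  map_mx (horner_eval a) (map_mx polyC N) = N.
Proof. by apply/matrixP => i j; rewrite !mxE /horner_eval hornerC. Qed.

(* The rows of [adj(a - M)] lie in the kernel of [a - M], which is a line since
   the adjugate is nonzero; so it is [z v^T], and applying it to [v] gives [z]. *)
Lemma adj_char_poly_mx_simple (F : fieldType) (n : nat) (M : 'M[F]_n) (a : F)
    (v : 'cV[F]_n) (g : {poly F}) :
  M^T = M -> M *m v = a *: v -> v^T *m v = 1%:M ->
  char_poly M = ('X - a%:P) * g -> g.[a] != 0 ->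
  map_mx (horner_eval a) (\adj (char_poly_mx M)) = g.[a] *: (v *m v^T).
Proof.
move=> Msym Mv vv pE ga0.
set P := char_poly_mx M.
have vM : v^T *m M = a *: v^T by rewrite -{1}Msym -trmx_mul Mv linearZ.
pose w := map_mx polyC v^T.
have wP : w *m P = ('X - a%:P) *: w.
  rewrite /P /char_poly_mx mulmxBr mul_mx_scalar -map_mxM vM.
  by rewrite map_mxZ scalerBl.
have Xa0 : 'X - a%:P != 0 by rewrite polyXsubC_eq0.
(* The factor ['X - a%:P] must be cancelled over polynomials, before evaluation at [a] makes it
   vanish. *)
have wadj : w *m \adj P = g *: w.
  have : w *m P *m \adj P = char_poly M *: w.
    by rewrite -mulmxA mul_mx_adj mul_mx_scalar.
  rewrite wP -scalemxAl pE -scalerA => /matrixP E.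
  by apply/matrixP => i j; move: (E i j); rewrite mxE [in RHS]mxE => /(mulfI Xa0).
pose B := map_mx (horner_eval a) (\adj P).
have evP : map_mx (horner_eval a) P = a%:M - M.
  rewrite /P /char_poly_mx map_mxB map_horner_polyC; congr (_ - _).
  by apply/matrixP => i j; rewrite !mxE raddfMn /= /horner_eval hornerX.
have BE : B = \adj (a%:M - M) by rewrite /B map_mx_adj evP.
have vB : v^T *m B = g.[a] *: v^T.
  move/(congr1 (map_mx (horner_eval a))): wadj.
  by rewrite map_mxM map_mxZ map_horner_polyC.
have Bsym : B^T = B by rewrite BE trmx_adj linearB /= tr_scalar_mx Msym.
have Bv : B *m v = g.[a] *: v.
  by rewrite -[v in LHS]trmxK -Bsym -trmx_mul vB linearZ /= trmxK.
have v0 : v^T != 0.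
  apply: contra_eq_neq vv => ->; rewrite mul0mx eq_sym.
  by apply/eqP => /matrixP/(_ 0 0)/eqP; rewrite !mxE eqxx oner_eq0.
have B0 : B != 0.
  apply: contraNneq ga0 => B0; move/eqP: vB; rewrite B0 mulmx0 eq_sym.
  by rewrite scaler_eq0 (negPf v0) orbF.
have Bker : (B <= kermx (a%:M - M))%MS.
  by apply/sub_kermxP; rewrite BE mul_adj_mx -evP det_map_mx [\det P]pE /=
    /horner_eval hornerM hornerXsubC subrr mul0r raddf0.
have vker : (v^T <= kermx (a%:M - M))%MS.
  by apply/sub_kermxP; rewrite mulmxBr vM mul_mx_scalar subrr.
have kerv : (kermx (a%:M - M) <= v^T)%MS.
  rewrite -(geq_leqif (mxrank_leqif_sup vker)) rank_rV v0 mxrank_ker.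
  by rewrite leq_subLR addn1 (leq_trans (leqSpred n)) // ltnS mxrank_adj_neq0 // -BE.
have /submxP [z zE] := submx_trans Bker kerv.
have zv : z = g.[a] *: v by rewrite -Bv zE -mulmxA vv mulmx1.
by rewrite -/P -/B zE zv scalemxAl.
Qed.

(** * Sorted real roots with multiplicity *)

(** Convertible to [eigenvalues M] when [p] is [char_poly M], so facts about its entry of index 1
    apply directly to [fiedler_value]. *)
Definition roots_with_mult (R : realType) (p : {poly R}) : seq R :=
  flatten [seq nseq (mup x p) x | x <- rootsR p].

Lemma mem_rootsR (R : realType) (p : {poly R}) (x : R) :
  p != 0 -> (x \in rootsR p) = root p x.
Proof. by move=> p0; rewrite -(roots_on_rootsR p0) in_itv. Qed.

Lemma mup_gt0_root (R : realType) (p : {poly R}) (x : R) :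
  p != 0 -> (0 < mup x p)%N = root p x.
Proof. by move=> p0; rewrite mup_geq // expr1 dvdp_XsubCl. Qed.

(** A simple smallest root fills index 0 only, so index 1 holds the next distinct root; [b]
    guarantees that there is one. *)
Lemma second_root (R : realType) (p : {poly R}) (a b : R) :
  p != 0 -> (forall x, root p x -> a <= x) -> mup a p = 1%N ->
  root p b -> a < b ->
  let y := (roots_with_mult p)`_1 in [/\ root p y, a < y & y <= b].
Proof.
move=> p0 lea mupa rb ab /=.
have ra : root p a by rewrite -mup_gt0_root // mupa.
have : sorted <%R (rootsR p) by apply: sorted_roots.
have : a \in rootsR p by rewrite mem_rootsR.
have : b \in rootsR p by rewrite mem_rootsR.
have : all (root p) (rootsR p) by apply/allP => x; rewrite mem_rootsR.
rewrite /roots_with_mult; case: (rootsR p) => //= x s1 /andP[rx rs1] bs as_ xs.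
have xa : x = a.
  apply/eqP; rewrite eq_le lea // andbT.
  move: as_; rewrite inE => /predU1P[->//|].
  by move: xs; rewrite lt_path_sortedE => /andP[/allP h _] /h /ltW.
subst x; rewrite mupa /=.
move: bs; rewrite inE gt_eqF //=.
case: s1 rs1 xs {as_} => //= y s2 /andP[ry rs2] /andP[ay ys].
have : (0 < mup y p)%N by rewrite mup_gt0_root.
case: (mup y p) => // k _ /=.
rewrite inE => /predU1P[->//|].
by move: ys; rewrite lt_path_sortedE => /andP[/allP h _] /h /ltW.
Qed.

(** A nonzero entry of index 1 is neither a second copy of the root 0 nor the default 0 of an
    exhausted list. Hence 0 is a simple root and the entry is the least positive root. *)
Lemma second_root_neq0 (R : realType) (p : {poly R}) :
  p != 0 -> (forall x, root p x -> 0 <= x) -> root p 0 ->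
  let y := (roots_with_mult p)`_1 in y != 0 ->
  [/\ root p y, 0 < y, mup 0 p = 1%N & forall x, root p x -> 0 < x -> y <= x].
Proof.
move=> p0 ge0 r0 /=.
have : sorted <%R (rootsR p) by apply: sorted_roots.
have mem x : (x \in rootsR p) = root p x by rewrite mem_rootsR.
move: mem; rewrite /roots_with_mult; case: (rootsR p) => [|x s1] /=.
  by rewrite eqxx.
move=> mem xs.
have x0 : x = 0.
  apply/eqP; rewrite eq_le ge0 ?andbT -?mem ?mem_head //.
  move: r0; rewrite -mem inE => /predU1P[->//|].
  by move: xs; rewrite lt_path_sortedE => /andP[/allP h _] /h /ltW.
subst x; move: r0; rewrite -mup_gt0_root //.
case m0 : (mup 0 p) => [//|[|k]] _ /=; last by rewrite eqxx.
case: s1 mem xs => [|y s2] mem /=; first by rewrite eqxx.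
case/andP => y0 ys.
have ry : root p y by rewrite -mem !inE eqxx orbT.
have : (0 < mup y p)%N by rewrite mup_gt0_root.
case: (mup y p) => // k _ /= _; split => // x; rewrite -mem !inE.
case/predU1P => [->|]; first by rewrite ltxx.
case/predU1P => [->//|].
by move: ys; rewrite lt_path_sortedE => /andP[/allP h _] /h /ltW.
Qed.

(** * Perturbation of a simple root of a real polynomial *)

Lemma poly_bounded_away (R : realType) (p : {poly R}) (a b : R) :
  a <= b -> (forall x, a <= x <= b -> ~~ root p x) ->
  exists2 c, 0 < c & forall x, a <= x <= b -> c <= `|p.[x]|.
Proof.
move=> ab nr.
have ct : {within `[a, b], continuous (fun x => `|p.[x]|)}.
  apply: continuous_subspaceT => x.
  by apply: cvg_norm; apply: continuous_horner.
have [c cab cmin] := EVT_min ab ct.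
exists `|p.[c]|; first by rewrite normr_gt0; apply: nr; rewrite in_itv in cab.
by move=> x xab; apply: cmin; rewrite in_itv.
Qed.

Lemma poly_bounded (R : realType) (p : {poly R}) (a b : R) :
  a <= b -> exists2 K, 0 < K & forall x, a <= x <= b -> `|p.[x]| <= K.
Proof.
move=> ab.
have ct : {within `[a, b], continuous (fun x => `|p.[x]|)}.
  apply: continuous_subspaceT => x.
  by apply: cvg_norm; apply: continuous_horner.
have [c cab cmax] := EVT_max ab ct.
exists (`|p.[c]| + 1); first by rewrite ltr_wpDl.
by move=> x xab; rewrite ler_wpDr //; apply: cmax; rewrite in_itv.
Qed.

(** Gives room beyond [m], since a perturbed root may fall on either side of it. *)
Lemma nonroot_extend_right (R : realType) (p : {poly R}) (a m : R) :
  (forall x, a <= x <= m -> ~~ root p x) -> a <= m ->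
  exists2 b, m < b & forall x, a <= x <= b -> ~~ root p x.
Proof.
move=> nr am.
have : \forall x \near m, p.[x] != 0.
  have := @continuous_horner R p m.
  by move/cvgr_neq0; apply; apply: nr; rewrite am lexx.
case/nbhs_ballP => e /= e0 he.
exists (m + e / 2); first by rewrite ltrDl divr_gt0.
move=> x /andP[ax xb]; have [xm|mx] := leP x m; first by apply: nr; rewrite ax.
apply: he; rewrite /ball /= distrC gtr0_norm; last by rewrite subr_gt0.
by move: xb; lra.
Qed.

(** With [c <= |g|] and [|s| <= K] on [[0, b]], a root [x] of [r] there satisfies
    [c |x - m| <= t K]. The estimate covers all of [[0, b]] so that it applies to the least positive
    root, wherever it lies below the root found by the sign change. *)
Lemma simple_root_perturbation (R : realType) (g s : {poly R}) (m : R) :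
  0 < m -> (forall x, 0 <= x <= m -> ~~ root g x) ->
  exists b K t0, [/\ m < b, 0 < t0 & forall t, 0 < t < t0 ->
    let r := ('X - m%:P) * g + t *: s in
    [/\ ~~ root r 0, exists2 x, 0 < x <= b & root r x &
        forall x, 0 <= x <= b -> root r x -> `|x - m| <= K * t]].
Proof.
move=> m0 nr.
have [b mb nrb] := nonroot_extend_right nr (ltW m0).
have b0 : 0 <= b by rewrite (le_trans (ltW m0)) ?ltW.
have [c c0 cP] := poly_bounded_away b0 nrb.
have [K K0 KP] := poly_bounded s b0.
(* This choice keeps [[m - d, m + d]] inside [(0, b]]. The threshold [d * c / K] makes [t |s|]
   smaller than [d |g|], so [t *: s] cannot compensate the main term at distance [d] or more from
   [m]. *)
pose d := Num.min (m / 2) (b - m).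
have d0 : 0 < d by rewrite lt_min; lra.
have dm : d <= m / 2 by rewrite ge_min lexx.
have db : d <= b - m by rewrite ge_min lexx orbT.
have t00 : 0 < d * c / K by rewrite divr_gt0 ?mulr_gt0.
exists b, (K / c), (d * c / K); split => // t /andP[t0 tt0] r.
have tK : t * K < d * c by rewrite -ltr_pdivlMr.
have rE x : r.[x] = (x - m) * g.[x] + t * s.[x] by rewrite /r !hornerE.
have close x : 0 <= x <= b -> root r x -> `|x - m| <= K / c * t.
  move=> xb /rootP; rewrite rE => /eqP; rewrite addr_eq0 => /eqP E.
  have : `|x - m| * c <= t * K.
    apply: le_trans (_ : `|(x - m) * g.[x]| <= _).
      by rewrite normrM ler_wpM2l ?cP.
    by rewrite E normrN normrM (gtr0_norm t0) ler_pM2l // KP.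
  by rewrite mulrAC ler_pdivlMr // [K * t]mulrC.
have far x : 0 <= x <= b -> d <= `|x - m| -> ~~ root r x.
  move=> xb dx; apply/negP => /(close _ xb); apply/negP; rewrite -ltNge.
  by apply: lt_le_trans dx; rewrite mulrAC ltr_pdivrMr // mulrC.
split => //.
  apply: far; first by rewrite lexx.
  by rewrite sub0r normrN gtr0_norm; lra.
(* [g] keeps a constant sign, hence [r] changes sign on [m - d, m + d] *)
have gsign : 0 < g.[m - d] * g.[m + d].
  rewrite ltNge; apply/negP => le0.
  have [|x xmd rx] := polyrcf.poly_ivt _ le0; first by lra.
  by have := nrb x; rewrite rx; case/(_ _)/negP => //; move: xmd; rewrite in_itv /=; lra.
(* At [m - d] and [m + d] the main terms are [- d g] and [d g], of opposite signs, and both dominate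
   [t s]. *)
have rsign : r.[m - d] * r.[m + d] <= 0.
  have c1 := cP (m - d) ltac:(lra); have c2 := cP (m + d) ltac:(lra).
  have k1 := KP (m - d) ltac:(lra); have k2 := KP (m + d) ltac:(lra).
  have bs x : 0 <= x <= b -> `|t * s.[x]| < d * c.
    by move=> xb; rewrite normrM gtr0_norm //; apply: le_lt_trans tK;
      rewrite ler_pM2l // KP.
  have /ltr_normlP[a1 a2] := bs (m - d) ltac:(lra).
  have /ltr_normlP[a3 a4] := bs (m + d) ltac:(lra).
  rewrite !rE (_ : m - d - m = - d); last by ring.
  rewrite (_ : m + d - m = d); last by ring.
  move: a1 a2 a3 a4; set y1 := t * _; set y2 := t * _ => a1 a2 a3 a4.
  move: gsign c1 c2; set g1 := g.[_]; set g2 := g.[_] => gs c1 c2.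
  have [g1p|g1n|g10] := ltgtP 0 g1; last by rewrite -g10 mul0r ltxx in gs.
  - have g2p : 0 < g2 by rewrite pmulr_rgt0 in gs.
    rewrite gtr0_norm // in c1; rewrite gtr0_norm // in c2.
    by rewrite mulr_le0_ge0 //; nra.
  - have g2n : g2 < 0 by rewrite nmulr_rgt0 in gs.
    rewrite ltr0_norm // in c1; rewrite ltr0_norm // in c2.
    by rewrite mulr_ge0_le0 //; nra.
have [|x xmd rx] := polyrcf.poly_ivt _ rsign; first by lra.
by exists x => //; move: xmd; rewrite in_itv /=; lra.
Qed.

(** The root equation reads [(f t - m) / t = - s(f t) / g(f t)], and the bound [K * t] forces [f t]
    to tend to [m]; continuity does the rest. *)
Lemma simple_root_derivative (R : realType) (g s : {poly R}) (m K : R)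
    (f : R -> R) :
  g.[m] != 0 ->
  (\forall t \near 0^'+, root (('X - m%:P) * g + t *: s) (f t) /\
                         `|f t - m| <= K * t) ->
  (f t - m) / t @[t --> 0^'+] --> - (s.[m] / g.[m]).
Proof.
move=> gm H.
have fm : f t @[t --> 0^'+] --> m.
  apply/cvgrPdist_lt => e e0.
  (* [K] has no prescribed sign; [|K| + 1] is a positive bound for it. *)
  have K1 : 0 < `|K| + 1 by rewrite ltr_wpDl.
  near=> t.
  have t0 : 0 < t by [].
  have [_ ft] : root (('X - m%:P) * g + t *: s) (f t) /\ `|f t - m| <= K * t.
    by near: t.
  rewrite distrC; apply: le_lt_trans ft _.
  have : t < e / (`|K| + 1) by near: t; apply: nbhs_right_lt; rewrite divr_gt0.
  rewrite ltr_pdivlMr // => te; have := ler_norm K; nra.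
have cg : g.[f t] @[t --> 0^'+] --> g.[m].
  exact: cvg_comp fm (@continuous_horner R g m).
have cs : s.[f t] @[t --> 0^'+] --> s.[m].
  exact: cvg_comp fm (@continuous_horner R s m).
have lim : - (s.[f t] / g.[f t]) @[t --> 0^'+] --> - (s.[m] / g.[m]).
  by apply: cvgN; apply: cvgM => //; apply: cvgV.
apply: cvg_trans lim; apply: near_eq_cvg.
near=> t.
have t0 : t != 0 by apply: lt0r_neq0.
have g0 : g.[f t] != 0 by near: t; move/cvgr_neq0: cg; apply.
have [/rootP + _] : root (('X - m%:P) * g + t *: s) (f t) /\ `|f t - m| <= K * t.
  by near: t.
rewrite !hornerE => /eqP; rewrite addr_eq0 => /eqP E.
apply/eqP; rewrite -mulNr eqr_div // mulrC E; apply/eqP; ring.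
Unshelve. all: by end_near.
Qed.

(** * Indicator sums and simple roots of products *)

Lemma sumr_mulrb_eq (V : nmodType) (I : finType) (F : I -> V) (l : I) :
  \sum_k F k *+ (k == l) = F l.
Proof. by rewrite (bigD1 l) //= eqxx big1 ?addr0 // => k /negPf ->. Qed.

Lemma mup_eq1 (F : fieldType) (p : {poly F}) (a : F) :
  p != 0 -> (mup a (('X - a%:P) * p) == 1%N) = ~~ root p a.
Proof.
move=> p0; rewrite mupM // ?polyXsubC_eq0 // -['X - _]expr1 mup_XsubCX eqxx.
by rewrite eqSS -leqn0 mup_leq // expr1 dvdp_XsubCl.
Qed.

(** * Spectrum of the graph Laplacian and its change under reweighting *)

Section Laplacian.
Variables (R : realType) (n : nat).
Implicit Types (A M : 'M[R]_n).

Lemma laplacianE A k l :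
  laplacian A k l = (\sum_m A k m) *+ (k == l) - A k l.
Proof. by rewrite !mxE. Qed.

Lemma tr_laplacian A : A^T = A -> (laplacian A)^T = laplacian A.
Proof. by move=> As; rewrite /laplacian linearB /= As tr_diag_mx. Qed.

(** The factor 2 appears because the sum runs over ordered pairs. Expanding the square, the two sums
    of pure squares agree by symmetry of [A]. *)
Lemma laplacian_quadratic_form A (x : 'rV[R]_n) : A^T = A ->
  (x *m laplacian A *m x^T) 0 0 *+ 2 =
  \sum_k \sum_l A k l * (x 0 k - x 0 l) ^+ 2.
Proof.
move=> As; have Akl k l : A k l = A l k by rewrite -{1}As mxE.
have -> : (x *m laplacian A *m x^T) 0 0 =
    \sum_k \sum_l A k l * (x 0 k * x 0 k) - \sum_k \sum_l A k l * (x 0 k * x 0 l).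
  rewrite !mxE (eq_bigr (fun l => (\sum_m A l m) * (x 0 l * x 0 l) -
      \sum_k A k l * (x 0 k * x 0 l))); last first.
    move=> l _; rewrite !mxE mulr_suml.
    rewrite (eq_bigr (fun k => (\sum_m A l m) * (x 0 l * x 0 l) *+ (k == l) -
      A k l * (x 0 k * x 0 l))); last first.
      move=> k _; rewrite laplacianE mulrBr mulrBl; congr (_ - _); last by ring.
      by case: eqP => [->|_]; rewrite ?mulr1n ?mulr0n ?mulr0 ?mul0r //; ring.
    rewrite sumrB; congr (_ - _).
    by rewrite sumr_mulrb_eq.
  rewrite sumrB; congr (_ - _); last by rewrite exchange_big.
  by apply: eq_bigr => k _; rewrite mulr_suml.
set S1 := \sum_k \sum_l A k l * (x 0 k * x 0 k); set S2 := (X in S1 - X).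
have S1' : S1 = \sum_k \sum_l A k l * (x 0 l * x 0 l).
  rewrite /S1 exchange_big; apply: eq_bigr => k _; apply: eq_bigr => l _.
  by rewrite Akl.
have -> : (S1 - S2) *+ 2 = S1 + S1 - S2 *+ 2 by rewrite mulrnBl mulr2n.
rewrite {2}S1' -big_split /= -sumrMnl -sumrB; apply: eq_bigr => k _.
rewrite -big_split /= -sumrMnl -sumrB; apply: eq_bigr => l _; ring.
Qed.

(** On an eigenvector [x] the quadratic form equals [a |x|^2], and it is a sum of nonnegative
    terms. *)
Lemma root_char_laplacian_ge0 A a :
  is_adjacency A -> root (char_poly (laplacian A)) a -> 0 <= a.
Proof.
case=> As _ A0; rewrite -eigenvalue_root_char => /eigenvalueP[x xL x0].
have := laplacian_quadratic_form x As.
rewrite xL -scalemxAl mxE => E.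
have sq : (x *m x^T) 0 0 = \sum_k x 0 k ^+ 2.
  by rewrite mxE; apply: eq_bigr => k _; rewrite mxE expr2.
have sq0 : 0 < \sum_k x 0 k ^+ 2.
  rewrite lt_neqAle sumr_ge0 ?andbT => [|k _]; last exact: sqr_ge0.
  rewrite eq_sym; apply: contraNneq x0 => /eqP.
  rewrite psumr_eq0 => [/allP h|k _]; last exact: sqr_ge0.
  by apply/eqP/rowP => k; rewrite mxE; apply/eqP; rewrite -sqrf_eq0 (implyP (h k _)) ?mem_index_enum.
rewrite -(pmulr_lge0 _ sq0) -(pmulrn_lge0 _ (isT : (0 < 2)%N)) -sq E.
by apply: sumr_ge0 => k _; apply: sumr_ge0 => l _; rewrite mulr_ge0 ?sqr_ge0.
Qed.

(** The all-ones row vector is in the kernel: symmetry turns the column sums of [A] into the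
    degrees. *)
Lemma root_char_laplacian0 A :
  (0 < n)%N -> A^T = A -> root (char_poly (laplacian A)) 0.
Proof.
move=> n0 As; rewrite -eigenvalue_root_char; apply/eigenvalueP.
exists (const_mx 1); last first.
  apply/eqP => /rowP/(_ (Ordinal n0))/eqP; rewrite !mxE; exact/negP/oner_neq0.
rewrite scale0r; apply/rowP => l; rewrite mxE [RHS]mxE.
rewrite (eq_bigr (fun k => (\sum_m A l m) *+ (k == l) - A l k)) => [|k _].
  by rewrite sumrB (sumr_mulrb_eq (fun=> _)) subrr.
rewrite mxE mul1r laplacianE -{2}As [A^T _ _]mxE.
by case: eqP => [->|].
Qed.

Lemma laplacian_reweight A (i j : 'I_n) t : A^T = A -> i != j ->
  let u : 'cV[R]_n := delta_mx i 0 - delta_mx j 0 in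
  laplacian (reweight_edge A i j t) = laplacian A - (t * A i j) *: (u *m u^T).
Proof.
move=> As ij u; have Aji : A j i = A i j by rewrite -{1}As mxE.
(* Since [i != j], the two changed positions are distinct, so the two indicator terms never
   overlap. *)
have rE k l : reweight_edge A i j t k l =
    A k l - t * A i j *+ ((k == i) && (l == j)) - t * A i j *+ ((k == j) && (l == i)).
  rewrite mxE !xpair_eqE; case: (eqVneq k i) => [->|ki] /=.
    rewrite (negPf ij) /=; case: eqP => [->|_] /=; rewrite ?mulr1n ?mulr0n; ring.
  case: (eqVneq k j) => [->|kj] /=; last by rewrite mulr0n; ring.
  by case: eqP => [->|_] /=; rewrite ?Aji ?mulr1n ?mulr0n; ring.
apply/matrixP => k l.
have uE : (u *m u^T) k l =
    ((k == i)%:R - (k == j)%:R) * ((l == i)%:R - (l == j)%:R).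
  by rewrite mxE big_ord1 !mxE !andbT.
transitivity (laplacian A k l - t * A i j * (u *m u^T) k l); last by rewrite !mxE.
rewrite !laplacianE {}uE.
have -> : \sum_m reweight_edge A i j t k m =
    \sum_m A k m - t * A i j *+ (k == i) - t * A i j *+ (k == j).
  rewrite (eq_bigr _ (fun m _ => rE k m)) !sumrB; congr (_ - _ - _).
    case: (k == i) => /=; last by rewrite big1.
    by rewrite (sumr_mulrb_eq (fun=> _)).
  case: (k == j) => /=; last by rewrite big1.
  by rewrite (sumr_mulrb_eq (fun=> _)).
rewrite rE; case: (eqVneq k l) => [<-{l}|kl].
  rewrite !mulr1n; case: (eqVneq k i) => [->|ki] /=.
    rewrite (negPf ij) /= ?mulr1n ?mulr0n; ring.
  by case: (eqVneq k j) => [->|kj] /=; rewrite ?mulr1n ?mulr0n; ring.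
rewrite !mulr0n; case: (eqVneq k i) kl => [->|ki] kl /=.
  rewrite (negPf ij) /= [l == i]eq_sym (negPf kl).
  by case: (eqVneq l j) => [->|lj] /=; rewrite ?mulr1n ?mulr0n; ring.
case: (eqVneq k j) kl => [->|kj] kl /=; last by rewrite ?mulr0n; ring.
rewrite [l == j]eq_sym (negPf kl).
by case: (eqVneq l i) => [->|li] /=; rewrite ?mulr1n ?mulr0n; ring.
Qed.

Lemma reweight_is_adjacency A (i j : 'I_n) t : 0 <= t <= 1 ->
  is_adjacency A -> is_adjacency (reweight_edge A i j t).
Proof.
move=> t01 [As Ad A0]; split.
- apply/matrixP => k l; have Akl : A l k = A k l by rewrite -{1}As mxE.
  by rewrite !mxE Akl !xpair_eqE orbC ![(l == _) && _]andbC.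
- by move=> k; rewrite mxE Ad mulr0 if_same.
- by move=> k l; rewrite mxE; case: ifP => // _; rewrite mulr_ge0 //; lra.
Qed.

End Laplacian.

(** * First-order variation of the Fiedler value *)

(** The determinant formula is used over the domain [{poly R}], where [char_poly M] is nonzero
    because it is monic. *)
Lemma char_poly_rank1_update (R : idomainType) (n : nat) (M : 'M[R]_n)
    (u : 'cV[R]_n) (c : R) :
  char_poly (M - c *: (u *m u^T)) = char_poly M +
    c *: (map_mx polyC u^T *m \adj (char_poly_mx M) *m map_mx polyC u) 0 0.
Proof.
have -> : char_poly (M - c *: (u *m u^T)) =
    \det (char_poly_mx M + map_mx polyC u *m (c%:P *: map_mx polyC u^T)).
  rewrite /char_poly /char_poly_mx map_mxB map_mxZ map_mxM -scalemxAr.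
  by rewrite opprB addrA addrAC.
rewrite det_rank1_update -/(char_poly M) ?monic_neq0 ?char_poly_monic //.
by rewrite -!scalemxAl mxE mul_polyC.
Qed.

Lemma fiedler_value_root (R : realType) (n : nat) (A : 'M[R]_n) :
  (0 < n)%N -> is_adjacency A -> fiedler_value A != 0 ->
  let p := char_poly (laplacian A) in
  [/\ root p (fiedler_value A), 0 < fiedler_value A, mup 0 p = 1%N &
      forall x, root p x -> 0 < x -> fiedler_value A <= x].
Proof.
move=> n0 Aadj mu0; apply: second_root_neq0 => //.
- by rewrite monic_neq0 ?char_poly_monic.
- by move=> x; apply: root_char_laplacian_ge0.
- by apply: root_char_laplacian0 => //; case: Aadj.
Qed.

Lemma fiedler_impact_mxE (R : realType) (n : nat) (A : 'M[R]_n) v (i j : 'I_n) :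
  (j < i)%N -> edge A i j ->
  fiedler_impact_mx A v i j =
    (fiedler_value A)^-1 * (A i j * (v i 0 - v j 0) ^+ 2).
Proof. by move=> ji eij; rewrite !mxE ji eij. Qed.

(** This is the classical derivative [v^T L' v] of a simple eigenvalue, with [L' = - w u u^T] and
    [u^T v = v_i - v_j]. *)
Lemma fiedler_perturbation (R : realType) (n : nat) (A : 'M[R]_n)
    (v : 'cV[R]_n) (i j : 'I_n) :
  (0 < n)%N -> is_adjacency A -> fiedler_value A != 0 ->
  simple_eigenvalue (laplacian A) (fiedler_value A) ->
  laplacian A *m v = fiedler_value A *: v -> v^T *m v = 1%:M ->
  i != j -> A i j != 0 ->
  (fiedler_value (reweight_edge A i j t) - fiedler_value A) / t
    @[t --> 0^'+] --> - (A i j * (v i 0 - v j 0) ^+ 2).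
Proof.
move=> n0 Aadj mu0 mu1 Lv vv ij w0.
have [rmu mup0 m01 mumin] := fiedler_value_root n0 Aadj mu0.
have As : A^T = A by case: Aadj.
move: mu1; rewrite /simple_eigenvalue.
set mu := fiedler_value A in mu0 rmu mup0 mumin Lv * => mu1.
set L := laplacian A in rmu m01 mumin Lv mu1; set w := A i j in w0 *.
have p0 : char_poly L != 0 by rewrite monic_neq0 ?char_poly_monic.
have [r pr] : exists r, char_poly L = 'X * r.
  have /factor_theorem[r ->] := root_char_laplacian0 n0 As.
  by exists r; rewrite subr0 mulrC.
have [g rg] : exists g, r = ('X - mu%:P) * g.
  have /factor_theorem[g ->] : root r mu.
    by move: rmu; rewrite pr rootM rootX (negPf mu0).
  by exists g; rewrite mulrC.
have r0 : r != 0 by apply: contraNneq p0 => r0; rewrite pr r0 mulr0.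
have g0 : g != 0 by apply: contraNneq r0 => g0; rewrite rg g0 mulr0.
have pG : char_poly L = ('X - mu%:P) * ('X * g) by rewrite pr rg mulrCA.
have Xg0 : 'X * g != 0 by rewrite mulf_neq0 ?polyX_eq0.
have gmu : ~~ root ('X * g) mu by rewrite -mup_eq1 // -pG mu1.
have r00 : ~~ root r 0 by rewrite -mup_eq1 // subr0 -pr m01.
(* A root of [g] at 0 would make 0 a multiple root of [char_poly L], one inside [(0, mu)] would
   contradict the minimality of [mu], and one at [mu] its simplicity. *)
have gnr x : 0 <= x <= mu -> ~~ root g x.
  move=> /andP[x0 xmu]; apply/negP => gx.
  have [xE|x0'] := eqVneq x 0.
    by move: r00; rewrite rg rootM -xE gx orbT.
  have xp : 0 < x by rewrite lt_neqAle eq_sym x0'.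
  have xE : x = mu.
    by apply/eqP; rewrite eq_le xmu mumin // pG !rootM gx !orbT.
  by move: gmu; rewrite -xE rootM gx orbT.
pose u : 'cV[R]_n := delta_mx i 0 - delta_mx j 0.
pose q := (map_mx polyC u^T *m \adj (char_poly_mx L) *m map_mx polyC u) 0 0.
have pt t : char_poly (laplacian (reweight_edge A i j t)) =
    char_poly L + (t * w) *: q.
  by rewrite laplacian_reweight // char_poly_rank1_update.
have adjt t : 0 <= t <= 1 -> is_adjacency (reweight_edge A i j t).
  by move=> t01; apply: reweight_is_adjacency.
(* Removing the edge altogether ([t = 1]) still leaves a Laplacian with eigenvalue 0; as
   [char_poly L] vanishes at 0 and [w] is nonzero, so does [q]. *)
have [s qs] : exists s, q = 'X * s.
  have : root (char_poly L + (1 * w) *: q) 0.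
    rewrite -pt root_char_laplacian0 //.
    by have [|] := adjt 1; rewrite ?lexx ?ler01.
  rewrite /root hornerD hornerZ pr hornerM hornerX mul0r add0r mul1r.
  rewrite mulf_eq0 (negPf w0) /= => /factor_theorem[s ->].
  by exists s; rewrite subr0 mulrC.
have ptr t : char_poly (laplacian (reweight_edge A i j t)) =
    'X * (('X - mu%:P) * g + t *: (w *: s)).
  by rewrite pt pr rg qs scalerA mulrDr -scalerAr.
(* Here [G] is ['X * g] and [q] is ['X * s], so the common factor [mu] cancels from
   [q(mu) / G(mu)]. *)
have -> : w * (v i 0 - v j 0) ^+ 2 = (w *: s).[mu] / g.[mu].
  have adjE := adj_char_poly_mx_simple (tr_laplacian As) Lv vv pG gmu.
  have qmu : q.[mu] = ('X * g).[mu] * (v i 0 - v j 0) ^+ 2.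
    have -> : q.[mu] = (u^T *m map_mx (horner_eval mu) (\adj (char_poly_mx L)) *m u) 0 0.
      by rewrite -{1}[u^T](map_horner_polyC mu) -{2}[u](map_horner_polyC mu) -!map_mxM [in RHS]mxE.
    have uv : u^T *m v = (v i 0 - v j 0)%:M.
      rewrite [LHS]mx11_scalar linearB /= mulmxBl !trmx_delta -!rowE.
      by rewrite !mxE.
    rewrite adjE -scalemxAr -scalemxAl mxE mulmxA uv -mulmxA.
    by rewrite -[u in v^T *m u]trmxK -trmx_mul uv tr_scalar_mx -scalar_mxM mxE eqxx expr2.
  move: qmu; rewrite qs !hornerM hornerX -mulrA => /(mulfI mu0) smu.
  rewrite hornerZ smu -mulrA [g.[mu] * _]mulrC -mulrA divff ?mulr1 //.
  by move: gmu; rewrite rootM negb_or => /andP[].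
have [b [K [t0 [mub t00 H]]]] := simple_root_perturbation (w *: s) mup0 gnr.
apply: (@simple_root_derivative _ _ _ _ K).
  by move: gmu; rewrite rootM negb_or => /andP[].
near=> t.
have tp : 0 < t by [].
have tt0 : t < t0 by near: t; apply: nbhs_right_lt.
have t1 : t < 1 by near: t; apply: nbhs_right_lt.
have [|nr0 [x /andP[xp xb] rx] close] := H t; first by rewrite tp.
set rt := (X in root X _) in nr0 rx close *.
have rt0 : rt != 0 by apply: contraNneq nr0 => ->; rewrite root0.
have tadj : is_adjacency (reweight_edge A i j t) by apply: adjt; rewrite !ltW.
have := ptr t; rewrite -/rt => pE.
(* The root [x] only bounds the new Fiedler value from above: this places it in [(0, b]], where
   [close] applies. The root 0 is simple because [rt] does not vanish there. *)
have [ry yp yb] : let y := fiedler_value (reweight_edge A i j t) in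
    [/\ root ('X * rt) y, 0 < y & y <= x].
  rewrite /= -pE; apply: second_root => //.
  - by rewrite monic_neq0 ?char_poly_monic.
  - by move=> y; apply: root_char_laplacian_ge0.
  - by apply/eqP; rewrite pE -['X]subr0 mup_eq1.
  - by rewrite pE rootM rx orbT.
have ry' : root rt (fiedler_value (reweight_edge A i j t)).
  by move: ry; rewrite rootM rootX gt_eqF.
by split => //; apply: close => //; rewrite ltW //= (le_trans yb).
Unshelve. all: by end_near.
Qed.

(** * Frobenius norm bounds *)

Lemma frobenius_normZ (R : realType) (p q : nat) (a : R) (M : 'M[R]_(p, q)) :
  0 <= a -> frobenius_norm (a *: M) = a * frobenius_norm M.
Proof.
move=> a0; rewrite /frobenius_norm -{2}(ger0_norm a0) -sqrtr_sqr -sqrtrM ?sqr_ge0 //.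
congr Num.sqrt; rewrite mulr_sumr; apply: eq_bigr => i _.
by rewrite mulr_sumr; apply: eq_bigr => j _; rewrite mxE exprMn.
Qed.

Lemma frobenius_norm_col1 (R : realType) (n : nat) (v : 'cV[R]_n) :
  frobenius_norm v = 1 -> \sum_i v i 0 ^+ 2 = 1.
Proof.
rewrite /frobenius_norm; under eq_bigr do rewrite big_ord1.
move=> /(congr1 (fun x => x ^+ 2)); rewrite sqr_sqrtr ?expr1n //.
by apply: sumr_ge0 => i _; apply: sqr_ge0.
Qed.

(** Each entry on an edge is at most [2 (v_i^2 + v_j^2) <= 2], so each edge contributes at most 4 to
    the sum of squares. *)
Lemma frobenius_norm_proj_diff_sq (R : realType) (n : nat) (A : 'M[R]_n)
    (v : 'cV[R]_n) :
  frobenius_norm v = 1 ->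
  frobenius_norm (proj_lower A (diff_sq_mx v)) <= 2 * Num.sqrt (num_edges A)%:R.
Proof.
move=> /frobenius_norm_col1 v1.
have two : 2 = Num.sqrt (2 ^+ 2) :> R by rewrite sqrtr_sqr ger0_norm.
rewrite {1}two -sqrtrM ?sqr_ge0 // /frobenius_norm ler_wsqrtr //.
rewrite pair_big /= /num_edges -sum1_card natr_sum mulr_sumr [leRHS]big_mkcond /=.
apply: ler_sum => -[i j] _; rewrite !inE !mxE /=.
case ji : (j < i)%N => /=; last by rewrite expr0n.
case: ifP => _; last by rewrite expr0n.
have ij : i != j by apply: contraTneq ji => ->; rewrite ltnn.
have vij : v i 0 ^+ 2 + v j 0 ^+ 2 <= 1.
  rewrite -v1 (bigD1 i) //= (bigD1 j) ?[j == i]eq_sym //= addrA lerDl.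
  by apply: sumr_ge0 => k _; apply: sqr_ge0.
have d2 : (v i 0 - v j 0) ^+ 2 <= 2.
  (* Uses [(a - b)^2 + (a + b)^2 = 2 (a^2 + b^2)]. *)
  have := sqr_ge0 (v i 0 + v j 0); nra.
by rewrite mulr1 ler_pXn2r ?nnegrE ?sqr_ge0.
Qed.

(** * Relative change of the Fiedler value and norm of the impact matrix *)

Lemma fiedler_value_ge0 (R : realType) (n : nat) (A : 'M[R]_n) :
  (0 < n)%N -> is_adjacency A -> 0 <= fiedler_value A.
Proof.
move=> n0 Aadj; have [->//|mu0] := eqVneq (fiedler_value A) 0.
by have [_ /ltW] := fiedler_value_root n0 Aadj mu0.
Qed.

(** The informal first-order estimate is made precise as a remainder of order [o(t)] when [t]
    decreases to 0. *)
Theorem proposition4 (R : realType) (n : nat) (A : 'M[R]_n) (v : 'cV[R]_n)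
    (n_ge2 : (1 < n)%N)
    (A_adj : is_adjacency A)
    (A_conn : connected_graph A)
    (mu_simple : simple_eigenvalue (laplacian A) (fiedler_value A))
    (v_fiedler : is_fiedler_vector A v) :
  (forall i j : 'I_n, (j < i)%N -> edge A i j ->
     (fiedler_impact A i j t - t * fiedler_impact_mx A v i j) / t
       @[t --> (0 : R)^'+] --> (0 : R)) /\
  (unweighted A ->
     frobenius_norm (fiedler_impact_mx A v)
       = (fiedler_value A)^-1
         * frobenius_norm (proj_lower A (diff_sq_mx v)) /\
     (fiedler_value A)^-1 * frobenius_norm (proj_lower A (diff_sq_mx v))
       <= 2 * Num.sqrt ((num_edges A)%:R) / fiedler_value A).
Proof.
have n0 : (0 < n)%N by apply: ltnW.
case: v_fiedler => Lv v1; have mu_ge0 := fiedler_value_ge0 n0 A_adj.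
split=> [i j ji eij|A1]; last first.
  split; last first.
    by rewrite mulrC ler_wpM2r ?invr_ge0 // frobenius_norm_proj_diff_sq.
  rewrite -frobenius_normZ ?invr_ge0 //; congr (frobenius_norm (_ *: _)).
  apply/matrixP => k l; rewrite !mxE; case: ifP => [/andP[_ /A1 ->]|_].
    by rewrite mul1r.
  by rewrite mul0r.
rewrite fiedler_impact_mxE //.
have [mu0|mu0] := eqVneq (fiedler_value A) 0.
  rewrite /fiedler_impact mu0 invr0 (_ : (fun t => _) = fun=> 0) //.
    exact: cvg_cst.
  by apply/funext => t; rewrite !(mulr0, mul0r, subr0).
have vv : v^T *m v = 1%:M.
  apply/matrixP => a b; rewrite !ord1 !mxE -(frobenius_norm_col1 v1) mulr1n.
  by apply: eq_bigr => k _; rewrite mxE expr2.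
have ij : i != j by apply: contraTneq ji => ->; rewrite ltnn.
have := fiedler_perturbation n0 A_adj mu0 mu_simple Lv vv ij eij.
set c := A i j * _; set mu := fiedler_value A => lim.
(* The impact divided by [t] is the difference quotient of the Fiedler value times [- mu^-1]; its
   limit [c / mu] is exactly the matrix entry. *)
have lim' : - ((fiedler_value (reweight_edge A i j t) - mu) / t) / mu - mu^-1 * c
    @[t --> 0^'+] --> - - c / mu - mu^-1 * c.
  apply: cvgB; last exact: cvg_cst.
  by apply: cvgMl; apply: cvgN.
rewrite (_ : - - c / mu - mu^-1 * c = 0) in lim'; last by rewrite opprK mulrC subrr.
apply: cvg_trans lim'; apply: near_eq_cvg; near=> t.
have t0 : t != 0 by apply: lt0r_neq0.
by rewrite /fiedler_impact -/mu; field; rewrite t0.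
Unshelve. all: by end_near.
Qed.
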